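(* For every integer $k\geq 3$ there is a constant $\gamma(k)>0$ such that for all positive integers $n$ and $b$ with $b<\gamma(k)\cdot n$, in the $b$-biased orientation game on the edges of $K_n$ Maker has a strategy guaranteeing that the obtained tournament contains a directed cycle $C_k$ of length exactly $k$.
   Context: The $b$-biased (i.e. $(1:b)$) orientation game on $K_n$: two players, Maker and Breaker, take turns in orienting previously undirected edges of the complete graph $K_n$. Maker starts. In each round Maker orients exactly one previously undirected edge, and then Breaker orients at least one and at most $b$ previously undirected edges (if any remain). The game ends when all edges are oriented, so that a tournament is obtained. In the $C_k$-creation game Maker wins if this tournament contains a directed cycle of length $k$ (a cyclically oriented $k$-cycle), no matter which player oriented each of its edges; otherwise Breaker wins. *)

(* Defs.v *)
From mathcomp Require Import all_boot.

Set Implicit Arguments.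
Unset Strict Implicit.
Unset Printing Implicit Defensive.

(* The pair (u, v) is the edge uv of K_n oriented from u to v. *)
Definition arc (n : nat) := ('I_n * 'I_n)%type.

Definition undirected (n : nat) (D : {set arc n}) (u v : 'I_n) : bool :=
  [&& u != v, (u, v) \notin D & (v, u) \notin D].

(* The last conjunct forbids orienting an edge both ways in the same move. *)
Definition legal_move (n : nat) (D A : {set arc n}) : bool :=
  [forall a in A, undirected D a.1 a.2 && ((a.2, a.1) \notin A)].

Definition all_oriented (n : nat) (D : {set arc n}) : bool :=
  [forall u, forall v, ~~ undirected D u v].

Definition has_directed_cycle (n k : nat) (D : {set arc n}) : Prop :=
  exists c : seq 'I_n, size c = k /\ ucycle [rel u v | (u, v) \in D] c.

(* The moves of both players so far, oldest first. *)
Definition history (n : nat) := seq {set arc n}.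

Definition position (n : nat) (h : history n) : {set arc n} :=
  \bigcup_(A <- h) A.

(* The value is only used at Maker's turns with an undirected edge left. *)
Definition maker_strategy (n : nat) := history n -> arc n.

Inductive player := Maker | Breaker.

(* [play b s p h]: h can arise, with p to move next, when Maker follows s and
   Breaker moves arbitrarily within the rules of the (1 : b) game. *)
Inductive play (n b : nat) (s : maker_strategy n) : player -> history n -> Prop :=
| play_start : play b s Maker [::]
| play_maker (h : history n) :
    play b s Maker h ->
    legal_move (position h) [set s h] ->
    play b s Breaker (rcons h [set s h])
| play_breaker (h : history n) (B : {set arc n}) :
    play b s Breaker h ->
    legal_move (position h) B ->
    1 <= #|B| <= b ->
    play b s Maker (rcons h B).

Definition valid_strategy (n b : nat) (s : maker_strategy n) : Prop :=
  forall h : history n, play b s Maker h ->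
    ~~ all_oriented (position h) -> legal_move (position h) [set s h].

(* The game may end after a move of either player. *)
Definition guarantees_cycle (n b k : nat) (s : maker_strategy n) : Prop :=
  forall (p : player) (h : history n), play b s p h ->
    all_oriented (position h) -> has_directed_cycle k (position h).

Definition maker_wins_cycle_game (n b k : nat) : Prop :=
  exists s : maker_strategy n, valid_strategy b s /\ guarantees_cycle b k s.

(* Main.v *)
Require Import Defs.
From mathcomp Require Import all_boot all_order all_algebra.
From mathcomp Require Import reals.
From mathcomp Require Import zify.

Import Order.TTheory GRing.Theory Num.Theory.
(* [arc] is to mean the arcs of the game, not the subpaths of [path]. *)
Import Defs.

Set Implicit Arguments.
Unset Strict Implicit.
Unset Printing Implicit Defensive.

(** Maker need not aim at a cycle at all: it is enough that the final
    tournament has no balanced one-way cut, that is, no set [A] with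
    [n <= 3 * #|A| <= 2 * n] which no arc leaves.

    A tournament without such a set has a strong set of more than [n / 3]
    vertices: between a minimal large out-closed set and a maximal out-closed
    set strictly inside it, where sizes jump from below [n / 3] to above
    [2 * n / 3], nothing out-closed fits, so the difference of the two is
    strong ([large_strong]).  By Moon's theorem a strong tournament has cycles
    of all lengths from 3 up to its size ([strong_pancyclic]).

    To destroy all balanced cuts, Maker plays greedily: among all ways to
    orient an open edge, the choice that leaves as few balanced sets without
    leaving arc as possible.  As long as at most [n ^ 2 / 9] edges are oriented,
    each surviving set [A] is left by at least [n ^ 2 / 9] of the at most
    [n ^ 2] possible moves, because [#|A| * #|~: A|] is at least
    [2 * n ^ 2 / 9].  By double counting some move kills a ninth of the
    survivors ([open_arc_sealing]).  When [b] is at most about [n / 54], Maker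
    has [6 * n] such rounds, and since [(9 / 8) ^ 6 > 2] they kill all of the
    at most [2 ^ n] sets ([no_sealed_set]).  Breaker's moves only help, as a
    killed set stays killed. *)

(** * Cycles in tournaments *)

Section Tournament.

Variables (T : finType) (e : rel T).
Hypothesis e_asym : forall x y, e x y -> ~~ e y x.
Hypothesis e_total : forall x y, x != y -> e x y || e y x.

Lemma e_irr x : e x x = false.
Proof. by apply/negP=> exx; move: (e_asym exx); rewrite exx. Qed.

(** Strong connectivity of the subtournament on [S], expressed by cuts: this
    is the form in which it is both obtained and used. *)
Definition strong (S : {set T}) : Prop :=
  forall A : {set T}, A != set0 -> A \proper S ->
    exists x y, [/\ x \in A, y \in S :\: A & e x y].

(** Some arc leads from the out-neighbours of a vertex [v] to the rest, and it
    can only end in an in-neighbour of [v]. *)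
Lemma strong_triangle (S : {set T}) :
  2 <= #|S| -> strong S ->
  exists c, [/\ size c = 3, ucycle e c & {subset c <= S}].
Proof.
move=> S2 strS; have /card_gt0P[v vS] : 0 < #|S| by exact: ltnW.
have [||x0 [x [/set1P-> /setDP[xS _] evx]]] := strS [set v].
- by apply/set0Pn; exists v; rewrite set11.
- by rewrite properEcard sub1set vS cards1.
have [||y [z [/setIdP[yS evy] /setDP[zS zO] eyz]]] := strS [set w in S | e v w].
- by apply/set0Pn; exists x; rewrite inE xS.
- apply/properP; split; first by apply/subsetP=> w; rewrite inE => /andP[].
  by exists v; rewrite // inE vS e_irr.
have evz : ~~ e v z by move: zO; rewrite inE zS.
have nzv : z != v by apply: contraTneq eyz => ->; exact: e_asym.
have ezv : e z v by move: (e_total nzv); rewrite (negPf evz) orbF.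
have nvy : v != y by apply: contraTneq evy => <-; rewrite e_irr.
have nyz : y != z by apply: contraTneq eyz => <-; rewrite e_irr.
exists [:: v; y; z]; split=> //.
  by rewrite /ucycle /= evy eyz ezv !inE negb_or nvy nyz (eq_sym v z) nzv.
by move=> w; rewrite !inE => /or3P[] /eqP->.
Qed.

(** A vertex [u] with an in-neighbour at the start of a path and an
    out-neighbour further on fits between two consecutive vertices: where the
    arcs to and from [u] first switch direction. *)
Lemma insert_in_path u x p :
  path e x p -> e x u -> u \notin p -> has (e u) p ->
  exists p', [/\ path e x p', last x p' = last x p & perm_eq p' (u :: p)].
Proof.
elim: p x => [|a p IHp] x //= /andP[exa pap] exu.
rewrite inE negb_or => /andP[nua up].
case eua: (e u a) => /= hup.
  by exists [:: u, a & p]; split=> //=; rewrite exu eua.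
have eau : e a u by move: (e_total nua); rewrite eua.
have [p' [pp' lp' perm_p']] := IHp a pap eau up hup.
exists (a :: p'); split=> //=; first by rewrite exa.
rewrite -(perm_cons a) in perm_p'; apply: perm_trans perm_p' _.
exact: permEl (perm_catCA [:: a] [:: u] p).
Qed.

Lemma insert_in_cycle u x y c :
  ucycle e c -> u \notin c -> x \in c -> y \in c -> e x u -> e u y ->
  exists c', ucycle e c' /\ perm_eq c' (u :: c).
Proof.
move=> uc uNc xc yc exu euy.
have [i p def_c] := rot_to xc.
have perm_c : perm_eq (x :: p) c by rewrite -def_c perm_rot.
have cyc : cycle e (x :: p) by rewrite -def_c rot_cycle; case/andP: uc.
have uNp : u \notin p.
  by move: uNc; rewrite -(perm_mem perm_c) inE negb_or => /andP[].
have yp : y \in p.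
  move: yc; rewrite -(perm_mem perm_c) inE => /orP[/eqP yx|//].
  by move: (e_asym exu); rewrite -yx euy.
move: cyc; rewrite /= rcons_path => /andP[pxp elx].
have [|p' [pp' lp' perm_p']] := insert_in_path pxp exu uNp.
  by apply/hasP; exists y.
have perm_c' : perm_eq (x :: p') (u :: c).
  apply: (@perm_trans _ (x :: u :: p)); first by rewrite perm_cons.
  apply: (@perm_trans _ (u :: x :: p)); last by rewrite perm_cons.
  exact: permEl (perm_catCA [:: x] [:: u] p).
exists (x :: p'); split=> //; rewrite /ucycle /= rcons_path pp' lp' elx /=.
by have := perm_uniq perm_c'; rewrite /= uNc => ->; case/andP: uc.
Qed.

(** The step of Moon's theorem.  If no outside vertex can be inserted in [c],
    then each one either is dominated by all of [c] or dominates all of [c]; by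
    strong connectivity some arc goes from a vertex [s] of the first kind to a
    vertex [t] of the second kind, and the detour through [s] and [t] can
    replace any single vertex of [c]. *)
Lemma lengthen_cycle (S : {set T}) c :
  strong S -> ucycle e c -> {subset c <= S} -> 2 <= size c < #|S| ->
  exists c', [/\ size c' = (size c).+1, ucycle e c' & {subset c' <= S}].
Proof.
move=> strS uc cS /andP[c2 ltcS].
have ltcS' : #|[set x in c]| < #|S|.
  by rewrite cardsE; apply: leq_ltn_trans (card_size c) ltcS.
case: (boolP [exists u in S, (u \notin c) && (has (e^~ u) c && has (e u) c)]).
  case/exists_inP=> u uS /and3P[uNc /hasP[x xc exu] /hasP[y yc euy]].
  have [c' [uc' perm_c']] := insert_in_cycle uc uNc xc yc exu euy.
  exists c'; split=> //; first by rewrite (perm_size perm_c').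
  by move=> z; rewrite (perm_mem perm_c') inE => /orP[/eqP->|/cS].
move/exists_inPn=> one_sided.
pose After := [set u in S | (u \notin c) && all (e^~ u) c].
have beforeP u x : u \in S -> u \notin c -> u \notin After -> x \in c -> e u x.
  move=> uS uNc; rewrite inE uS uNc /= => /allPn[y yc neyu] xc.
  have euy : e u y.
    have nuy : u != y by apply: contraNneq uNc => ->.
    by move: (e_total nuy); rewrite (negPf neyu) orbF.
  have := one_sided u uS; rewrite uNc /= negb_and.
  have -> : has (e u) c by apply/hasP; exists y.
  rewrite orbF => /hasPn/(_ x xc) nexu.
  have nux : u != x by apply: contraNneq uNc => ->.
  by move: (e_total nux); rewrite (negPf nexu) orbF.
(* With no vertex after [c], no arc would leave [c]. *)
have [After0|AfterN0] := eqVneq After set0.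
  have [||x [y [xc /setDP[yS yNc] exy]]] := strS [set x in c].
  - case: (c) c2 => [//|x0 ? _]; apply/set0Pn; exists x0.
    by rewrite inE mem_head.
  - rewrite properEcard ltcS' andbT; apply/subsetP=> z; rewrite inE; exact: cS.
  rewrite !inE in xc yNc.
  by move: (e_asym exy); rewrite beforeP // After0 inE.
have [//||s [t [sA /setDP[tS tA] est]]] := strS After.
  apply/properP; split; first by apply/subsetP=> w; rewrite inE => /andP[].
  case: (c) c2 cS @After {one_sided beforeP AfterN0} => [//|x0 p] _ cS.
  by exists x0; [apply: cS | rewrite inE]; rewrite mem_head // andbF.
move: (sA); rewrite inE => /and3P[sS sNc /allP cs].
have tNc : t \notin c by apply: contraL est => /cs; exact: e_asym.
have tc x : x \in c -> e t x by exact: beforeP.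
have nst : s != t by apply: contraNneq tA => <-.
clear ltcS ltcS' one_sided beforeP AfterN0 sA tA; clear After.
case: c c2 uc cS tc cs sNc tNc => [|x [|y p]] //= _ uc cS tc cs sNc tNc.
(* The detour skips [y]; [t] dominates whatever follows it on the cycle. *)
exists [:: x, s, t & p]; split=> //=.
  move: uc; rewrite /ucycle /= !inE => /and3P[/andP[_ pyp] xNp /andP[yNp up]].
  move: sNc tNc xNp; rewrite !inE !negb_or.
  move=> /and3P[sx sy sp] /and3P[tx ty tp] /andP[xy xp].
  rewrite cs ?mem_head // est nst sp tp up xp !(eq_sym x) sx tx !andbT /=.
  have : {subset rcons p x <= [:: x, y & p]}.
    by move=> z; rewrite mem_rcons !inE => /orP[]->; rewrite ?orbT.
  case: (rcons p x) pyp => //= z q /andP[_ ->] sub.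
  by rewrite tc // sub // mem_head.
move=> z; rewrite !inE => /or4P[/eqP->|/eqP->|/eqP->|zp] //; apply: cS.
  exact: mem_head.
by rewrite !inE zp !orbT.
Qed.

Lemma strong_pancyclic (S : {set T}) k :
  strong S -> 3 <= k <= #|S| ->
  exists c, [/\ size c = k, ucycle e c & {subset c <= S}].
Proof.
move=> strS; elim: k => // k IHk /andP[].
rewrite leq_eqVlt => /predU1P[<- S3|k3 ltkS].
  by apply: strong_triangle => //; exact: ltnW.
have [|c [sz_c uc cS]] := IHk; first by rewrite -ltnS k3 ltnW.
rewrite -sz_c; apply: lengthen_cycle => //.
by rewrite sz_c ltkS andbT -ltnS ltnW.
Qed.

Definition out_closed (A : {set T}) : bool :=
  [forall x in A, forall y, e x y ==> (y \in A)].

Lemma out_closedP (A : {set T}) :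
  reflect (forall x y, x \in A -> e x y -> y \in A) (out_closed A).
Proof.
apply: (iffP forall_inP) => clA x.
  by move=> y xA exy; have /forallP/(_ y)/implyP := clA x xA; apply.
by move=> xA; apply/forallP=> y; apply/implyP=> exy; exact: clA exy.
Qed.

Definition balanced (A : {set T}) : bool := #|T| <= 3 * #|A| <= 2 * #|T|.

(** [X] and [Y] are consecutive out-closed sets around the forbidden range of
    sizes; a subset of [X :\: Y] without arcs to the rest of [X :\: Y] would,
    joined with [Y], be out-closed strictly between them. *)
Lemma large_strong :
  0 < #|T| ->
  (forall A, balanced A -> ~~ out_closed A) ->
  exists2 S, strong S & #|T| < 3 * #|S|.
Proof.
move=> T0 noA.
have [|X /minsetP[/andP[/out_closedP clX bigX] minX] _] :=
    @minset_exists _ (fun A => out_closed A && (#|T| <= 3 * #|A|)) setT.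
  by rewrite cardsT leq_pmull // andbT; apply/out_closedP=> x y; rewrite !inE.
have hugeX : 2 * #|T| < 3 * #|X|.
  rewrite ltnNge; apply: contraL (introT (out_closedP X) clX) => leX.
  by apply: noA; rewrite /balanced bigX.
have [|Y /maxsetP[/andP[/out_closedP clY prY] maxY] _] :=
    @maxset_exists _ (fun A => out_closed A && (A \proper X)) set0.
  apply/andP; split; first by apply/out_closedP=> x y; rewrite inE.
  by rewrite proper0 -card_gt0; lia.
have smallY : 3 * #|Y| < #|T|.
  rewrite ltnNge; apply/negP=> bigY; move: (prY); rewrite (minX Y) ?properxx //.
    by rewrite bigY andbT; apply/out_closedP.
  exact: proper_sub.
have sYX := proper_sub prY.
exists (X :\: Y); last by rewrite cardsD (setIidPr sYX); lia.
move=> A A0 prA; have sAXY := proper_sub prA.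
have [/exists_inP[x xA /exists_inP[y yXYA exy]]|noarc] :=
    boolP [exists x in A, exists y in (X :\: Y) :\: A, e x y].
  by exists x, y.
suff YA : Y :|: A = Y.
  have /set0Pn[x xA] := A0; have /setDP[_ /negP[]] := subsetP sAXY x xA.
  by rewrite -YA inE xA orbT.
apply: maxY (subsetUl Y A); apply/andP; split.
  apply/out_closedP=> x y; rewrite !inE => /orP[xY exy|xA exy].
    by rewrite (clY x y).
  have /setDP[xX _] := subsetP sAXY x xA.
  move/exists_inPn/(_ x xA)/exists_inPn/(_ y): noarc.
  rewrite !inE exy (clX x y xX exy) andbT.
  by case: (y \in Y); case: (y \in A) => //= /(_ isT).
have /properP[_ [z /setDP[zX zY] zA]] := prA.
apply/properP; split; last by exists z; rewrite // inE negb_or zY.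
rewrite subUset sYX; apply: subset_trans sAXY _; exact: subsetDl.
Qed.

Lemma cycle_of_no_balanced_closed k :
  3 <= k -> 3 * k <= #|T| ->
  (forall A, balanced A -> ~~ out_closed A) ->
  exists c, size c = k /\ ucycle e c.
Proof.
move=> k3 kT noA; have [|S strS bigS] := large_strong _ noA; first by lia.
have [|c [sz_c uc _]] := strong_pancyclic (k := k) strS; first by lia.
by exists c.
Qed.

End Tournament.

(** * Destroying balanced cuts greedily *)

Section Greedy.

Variable n : nat.
Implicit Types (D E : {set arc n}) (A : {set 'I_n}).

Definition arc_rel D : rel 'I_n := [rel u v | (u, v) \in D].

Definition leaves A (a : arc n) : bool := (a.1 \in A) && (a.2 \notin A).

Definition open_arcs D : {set arc n} := [set a | undirected D a.1 a.2].

Definition sealed_sets D : {set {set 'I_n}} :=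
  [set A | balanced A & out_closed (arc_rel D) A].

Lemma sealedP D A :
  reflect (forall a, a \in D -> ~~ leaves A a) (out_closed (arc_rel D) A).
Proof.
apply: (iffP (out_closedP _ _)) => [clA [u v] uvD | clA u v uA uvD].
  by apply/negP=> /andP[/= uA /negP[]]; exact: clA uvD.
by apply: contraT => vA; case/negP: (clA _ uvD); rewrite /leaves /= uA.
Qed.

Lemma sealed_setsU D E :
  sealed_sets (D :|: E) =
    [set A in sealed_sets D | [forall a in E, ~~ leaves A a]].
Proof.
apply/setP=> A; rewrite !inE -andbA; congr (_ && _).
apply/sealedP/andP => [clA|[/sealedP clD /forall_inP clE] a].
  split; first by apply/sealedP=> a aD; apply: clA; rewrite inE aD.
  by apply/forall_inP=> a aE; apply: clA; rewrite inE aE orbT.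
by rewrite inE => /orP[/clD|/clE].
Qed.

Lemma sealed_setsS D E : D \subset E -> sealed_sets E \subset sealed_sets D.
Proof.
move/setUidPr <-; rewrite sealed_setsU; apply/subsetP=> A.
by rewrite inE => /andP[].
Qed.

(** At least [2 * n ^ 2 / 9] pairs go from [A] to its complement; as no arc
    leaves [A], each of them that is not open is the reverse of an arc of
    [D]. *)
Lemma leaving_open_arcs D A :
  A \in sealed_sets D ->
  2 * n ^ 2 <= 9 * (#|[set a in open_arcs D | leaves A a]| + #|D|).
Proof.
rewrite inE /balanced card_ord => /andP[balA /sealedP clA].
have cut : setX A (~: A) \subset [set a in open_arcs D | leaves A a]
             :|: [set (a.2, a.1) | a in D].
  apply/subsetP=> -[u v]; rewrite !inE /leaves /= => /andP[uA vA].
  rewrite uA vA andbT /undirected.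
  have -> /= : u != v by apply: contraNneq vA => <-.
  have -> /= : (u, v) \notin D.
    by apply: contraL uA => /clA; rewrite /leaves /= vA andbT.
  by case: (boolP ((v, u) \in D)) => //= vuD; apply/imsetP; exists (v, u).
have rev_le : #|[set (a.2, a.1) | a in D]| <= #|D| by exact: leq_imset_card.
have := leq_trans (subset_leq_card cut) (leq_card_setU _ _).
move/leq_trans/(_ (leq_add (leqnn _) rev_le)); rewrite cardsX => cut_le.
apply: leq_trans (leq_mul (leqnn 9) cut_le).
have := cardsC A; rewrite card_ord; set c := #|~: A| => sum_n.
move: balA sum_n; set a := #|A| => /andP[ca ac] sum_n.
(* The difference of the two sides is [(2 * a - c) * (2 * c - a)], and balance
   makes both factors nonnegative. *)
have [x ax] : exists x, 2 * a = c + x by exists (2 * a - c); lia.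
have [y ay] : exists y, 2 * c = a + y by exists (2 * c - a); lia.
rewrite -sum_n; nia.
Qed.

(** Double counting of the pairs of a surviving set and an open arc leaving it.
    Both orientations of an open edge count as separate arcs, so that a bound
    on the average already chooses the direction. *)
Lemma open_arc_sealing D :
  0 < n ->
  sealed_sets D != set0 -> 9 * #|D| <= n ^ 2 ->
  exists2 a, a \in open_arcs D &
    9 * #|sealed_sets (a |: D)| <= 8 * #|sealed_sets D|.
Proof.
move=> n_gt0 F0 smallD; set F := sealed_sets D in F0 *.
pose killed a := #|[set A in F | leaves A a]|.
have killedE a : #|sealed_sets (a |: D)| + killed a = #|F|.
  have -> : sealed_sets (a |: D) = [set A in F | ~~ leaves A a].
    rewrite setUC sealed_setsU; apply/setP=> A; rewrite !inE; congr (_ && _).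
    apply/forall_inP/idP => [|? b /set1P-> //]; apply; exact: set11.
  rewrite addnC -(cardsID [set A | leaves A a] F) /killed; congr (_ + _).
    by apply: eq_card => A; rewrite !inE.
  by apply: eq_card => A; rewrite !inE andbC.
have double_count : \sum_(a in open_arcs D) killed a
    = \sum_(A in F) #|[set a in open_arcs D | leaves A a]|.
  under eq_bigr => a _ do rewrite /killed -sum1dep_card big_mkcondr /=.
  under [RHS]eq_bigr => A _ do rewrite -sum1dep_card big_mkcondr /=.
  exact: exchange_big.
have many : #|F| * n ^ 2 <= 9 * \sum_(a in open_arcs D) killed a.
  rewrite double_count big_distrr /= -sum_nat_const; apply: leq_sum => A AF.
  have := leaving_open_arcs AF; move: smallD.
  by move: #|D| #|[set _ in _ | _]| (n ^ 2) => d x m; lia.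
apply/exists_inP; apply: contraT => /exists_inPn none.
have few a : a \in open_arcs D -> 9 * killed a < #|F|.
  by move/none; rewrite -ltnNge -(killedE a); move: (killed a) => ?; lia.
have F_gt0 : 0 < #|F| by rewrite card_gt0.
have n2_gt0 : 0 < n ^ 2 by rewrite expn_gt0 n_gt0.
have open_le : #|open_arcs D| <= n ^ 2.
  by apply: leq_trans (max_card _) _; rewrite card_prod card_ord.
have : \sum_(a in open_arcs D) 9 * killed a <= #|open_arcs D| * #|F|.-1.
  by rewrite -sum_nat_const; apply: leq_sum => a /few; lia.
rewrite -big_distrr /= => /(leq_trans many); rewrite leqNgt => /negP[].
apply: leq_ltn_trans (leq_mul open_le (leqnn _)) _.
by rewrite mulnC ltn_pmul2r // ltn_predL.
Qed.

(** [a0] only serves as a value when no edge is open. *)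
Definition greedy_arc (a0 : arc n) D : arc n :=
  [arg min_(a < odflt a0 [pick a in open_arcs D] in open_arcs D)
     #|sealed_sets (a |: D)|].

Lemma greedy_arcP a0 D : ~~ all_oriented D ->
  greedy_arc a0 D \in open_arcs D /\
  forall a, a \in open_arcs D ->
    #|sealed_sets (greedy_arc a0 D |: D)| <= #|sealed_sets (a |: D)|.
Proof.
move=> /forallPn[u /forallPn[v]]; rewrite negbK => uv.
have uv_open : (u, v) \in open_arcs D by rewrite inE.
rewrite /greedy_arc; case: arg_minnP; last by [].
by case: pickP => // /(_ (u, v)); rewrite uv_open.
Qed.

Lemma position_rcons (h : history n) B :
  position (rcons h B) = B :|: position h.
Proof. by rewrite /position -cats1 big_cat big_seq1 setUC. Qed.

End Greedy.

(** * The game *)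

Lemma eight_ninths_pow m : 0 < m -> 8 ^ (6 * m) * 2 ^ m < 9 ^ (6 * m).
Proof.
move=> m_gt0; rewrite !expnM -expnMn.
have lt1 : 8 ^ 6 * 2 < 9 ^ 6 by lia.
by move: lt1; move: (_ * 2) (9 ^ 6) => x y; rewrite ltn_exp2r.
Qed.

Section Game.

Variables (n b : nat) (a0 : arc n).
Hypothesis b_small : 54 * b.+1 <= n.

Definition greedy_strategy : maker_strategy n :=
  fun h => greedy_arc a0 (position h).

Lemma greedy_strategy_valid : valid_strategy b greedy_strategy.
Proof.
move=> h _ /(greedy_arcP a0)[]; rewrite inE -/(greedy_strategy h) => und _.
apply/forall_inP=> _ /set1P->; rewrite und inE /=.
case/and3P: und => neq _ _; apply: contra neq => /eqP.
by case: (greedy_strategy h) => u v /= [->].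
Qed.

Lemma play_asym s p (h : history n) : play b s p h ->
  forall u v, (u, v) \in position h -> (v, u) \notin position h.
Proof.
have step (g : history n) B : legal_move (position g) B ->
    (forall u v, (u, v) \in position g -> (v, u) \notin position g) ->
  forall u v, (u, v) \in position (rcons g B) ->
    (v, u) \notin position (rcons g B).
  move=> /forall_inP legB asym u v; rewrite position_rcons !inE negb_or.
  case/orP=> [uvB|uvD].
    by have /andP[/and3P[_ _ ->] ->] := legB _ uvB.
  rewrite asym // andbT; apply/negP=> /legB /andP[/and3P[_ _]].
  by rewrite /= uvD.
elim=> {p h} [u v|h _ IH leg|h B _ IH leg _].
- by rewrite /position big_nil inE.
- exact: step.
- exact: step.
Qed.

Lemma legal_move_open (D : {set arc n}) B :
  legal_move D B -> 0 < #|B| -> ~~ all_oriented D.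
Proof.
move=> /forall_inP legB /card_gt0P[a /legB/andP[und _]].
by apply/forallPn; exists a.1; apply/forallPn; exists a.2; rewrite negbK.
Qed.

Definition maker_moves (h : history n) := uphalf (size h).

Lemma play_parity s p (h : history n) : play b s p h ->
  odd (size h) = if p is Breaker then true else false.
Proof.
by elim=> // {p}h => [_|B _] IH *; rewrite size_rcons /= IH.
Qed.

Lemma maker_moves_rcons (h : history n) B :
  maker_moves (rcons h B) = ~~ odd (size h) + maker_moves h.
Proof. by rewrite /maker_moves size_rcons /=; lia. Qed.

(** After Maker's move the bound leaves room for the [b] arcs to come from
    Breaker. *)
Lemma card_position s p (h : history n) : play b s p h ->
  #|position h| + (if p is Breaker then b else 0) <= maker_moves h * b.+1.
Proof.
elim=> {p h} [|h ph IH leg|h B ph IH leg /andP[_ leB]].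
- by rewrite /position big_nil cards0.
- have [+ _] := leq_card_setU [set s h] (position h).
  rewrite position_rcons maker_moves_rcons (play_parity ph) cards1 /=.
  by move: IH; move: #|_ |: _| #|_| => x y; lia.
- have [+ _] := leq_card_setU B (position h).
  rewrite position_rcons maker_moves_rcons (play_parity ph) /=.
  by move: IH leB; move: #|_ :|: _| #|B| #|_| => x y z; lia.
Qed.

(** The minimum stops the count after [6 * n] rounds: the gain of a ninth is
    only ensured while few edges are oriented. *)
Lemma sealed_sets_decay p h : play b greedy_strategy p h ->
  let m := minn (maker_moves h) (6 * n) in
  9 ^ m * #|sealed_sets (position h)| <= 8 ^ m * 2 ^ n.
Proof.
have shrink (g : history n) B :
    #|sealed_sets (position (rcons g B))| <= #|sealed_sets (position g)|.
  by rewrite position_rcons; apply/subset_leq_card/sealed_setsS/subsetUr.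
elim=> {p h} [|h ph IH leg|h B ph IH leg _] /=.
- rewrite min0n !mul1n; apply: leq_trans (max_card _) _.
  by rewrite -cardsT -powersetT card_powerset cardsT card_ord.
- have leF := shrink h [set greedy_strategy h].
  rewrite maker_moves_rcons (play_parity ph) add1n /=.
  have [late|early] := leqP (6 * n) (maker_moves h).
    move: IH; rewrite /= (minn_idPr late) (minn_idPr (leqW late)).
    by apply: leq_trans; rewrite leq_mul2l leF orbT.
  move: IH; rewrite /= (minn_idPl early) (minn_idPl (ltnW early)) !expnS => IH.
  have [F0|F_neq0] := eqVneq (sealed_sets (position h)) set0.
    by move: leF; rewrite F0 cards0 leqn0 => /eqP->; rewrite muln0.
  have n_gt0 : 0 < n by lia.
  have smallD : 9 * #|position h| <= n ^ 2.
    by have := card_position ph; rewrite /=; nia.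
  have [a /[swap] decay aD] := open_arc_sealing n_gt0 F_neq0 smallD.
  have h_open : ~~ all_oriented (position h).
    by apply: legal_move_open leg _; rewrite cards1.
  have [_ /(_ a aD)] := greedy_arcP a0 h_open.
  rewrite -/(greedy_strategy h) => best; rewrite position_rcons.
  rewrite -!mulnA; apply: leq_trans (leq_mul (leqnn 8) IH).
  rewrite !(mulnCA _ (9 ^ _)) leq_mul2l; apply/orP; right.
  exact: leq_trans (leq_mul (leqnn 9) best) decay.
- rewrite maker_moves_rcons (play_parity ph) add0n.
  by apply: leq_trans IH; rewrite leq_mul2l shrink orbT.
Qed.

(** With all edges oriented, the pairs across a surviving cut account for
    [2 * n ^ 2 / 9] arcs, too many for fewer than [6 * n] rounds. *)
Lemma no_sealed_set p h :
  play b greedy_strategy p h -> all_oriented (position h) ->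
  sealed_sets (position h) = set0.
Proof.
move=> ph full; apply/eqP; apply: contraT => /[dup] F_neq0 /set0Pn[A AF].
have no_open : [set a in open_arcs (position h) | leaves A a] = set0.
  apply/setP=> -[u v]; rewrite !inE.
  by have /forallP/(_ u)/forallP/(_ v)/negPf-> := full.
have := leaving_open_arcs AF; rewrite no_open cards0 add0n => large.
have late : 6 * n <= maker_moves h.
  by have := card_position ph; nia.
have := sealed_sets_decay ph.
rewrite /= (minn_idPr late) leqNgt => /negP[].
apply: (@leq_trans (9 ^ (6 * n))); first by apply: eight_ninths_pow; lia.
by rewrite leq_pmulr // card_gt0.
Qed.

Lemma greedy_guarantees_cycle k :
  3 <= k -> 3 * k <= n -> guarantees_cycle b k greedy_strategy.
Proof.
move=> k3 kn p h ph full.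
have asym u v : arc_rel (position h) u v -> ~~ arc_rel (position h) v u.
  exact: play_asym ph u v.
have total u v : u != v ->
    arc_rel (position h) u v || arc_rel (position h) v u.
  move=> nuv; have /forallP/(_ u)/forallP/(_ v) := full.
  by rewrite /undirected nuv -negb_or negbK.
apply: (cycle_of_no_balanced_closed asym total k3); first by rewrite card_ord.
move=> A balA; have /setP/(_ A) := no_sealed_set ph full.
by rewrite !inE balA /= => ->.
Qed.

End Game.

Local Open Scope ring_scope.

Theorem proposition5p2 (R : realType) (k : nat) (hk : (3 <= k)%N) :
  exists gamma : R, 0 < gamma /\
    forall n b : nat, (0 < n)%N -> (0 < b)%N -> b%:R < gamma * n%:R ->
      maker_wins_cycle_game n b k.
Proof.
(* As [b] and [k] are positive, [108 * k * b < n] bounds both [54 * b.+1] and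
   [3 * k] by [n]. *)
have k108 : 0 < (108 * k)%:R :> R by rewrite ltr0n; lia.
exists (108 * k)%:R^-1; split; first by rewrite invr_gt0.
move=> n b n0 b0; rewrite ltr_pdivlMl // -natrM ltr_nat => bn.
pose a0 : arc n := (Ordinal n0, Ordinal n0).
exists (greedy_strategy a0); split; first exact: greedy_strategy_valid.
by apply: greedy_guarantees_cycle => //; nia.
Qed.
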